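(* Let $A_1,\ldots,A_m\in\mathbb{M}_d$. Then there exists a unitary matrix $V\in\mathbb{M}_d$ such that $$\left|\sum_{k=1}^m A_k\right|\le\left\{\sum_{k=1}^m|A_k|_{\vee}\right\}\#\left(V\left\{\sum_{k=1}^m|A_k|_{\vee}\right\}V^*\right).$$
   Context: $d,m\ge 1$ are integers, $\mathbb{M}_d$ is the space of complex $d\times d$ matrices and $\mathbb{M}_d^+$ its cone of positive semidefinite matrices; $\le$ between Hermitian matrices is the Loewner order. For $A\in\mathbb{M}_d$, $|A|=(A^*A)^{1/2}$, so $|A^*|=(AA^* )^{1/2}$. The maximal modulus of $A$ is the positive semidefinite matrix defined by Kato's formula $$|A|_{\vee}:=\lim_{n\to\infty}\left(|A|^n+|A^*|^n\right)^{1/n}$$ (the limit exists; it is the supremum of $|A|$ and $|A^*|$ in Olson's spectral order). For $X,Y\in\mathbb{M}_d^+$, $X\#Y$ denotes the matrix geometric mean: for $X,Y$ positive definite $X\#Y=X^{1/2}(X^{-1/2}YX^{-1/2})^{1/2}X^{1/2}$, and in general $X\#Y=\lim_{\varepsilon\downarrow 0}(X+\varepsilon I)\#(Y+\varepsilon I)$. Equivalently, $X\#Y$ is the largest (in the Loewner order) Hermitian $H$ such that the block matrix $\begin{bmatrix}X&H\\H&Y\end{bmatrix}$ is positive semidefinite. *)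

(* Defs.v *)
From HB Require Import structures.
From mathcomp Require Import all_boot all_order all_algebra.
From mathcomp Require Import complex.
From mathcomp Require Import all_classical all_reals all_analysis.

Set Implicit Arguments.
Unset Strict Implicit.
Unset Printing Implicit Defensive.

Import Order.TTheory GRing.Theory Num.Theory.
Import numFieldNormedType.Exports.

Local Open Scope classical_set_scope.
Local Open Scope ring_scope.
Local Open Scope sesquilinear_scope.

Section MatrixModulus.
Variables (C : numClosedFieldType) (d : nat).
Implicit Types X Y A : 'M[C]_d.

(* In a numClosedFieldType, [0 <= z] entails that z is real. *)
Definition psdmx X : Prop :=
  X \is hermsymmx /\ forall u : 'cV[C]_d, 0 <= (u^t* *m X *m u) 0 0.

Definition loewner_le X Y : Prop := psdmx (Y - X).

(* Functional calculus of a normal matrix, see [orthomx_spectralP]; the value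
   is independent of the diagonalization. *)
Definition mxfun (f : C -> C) X : 'M[C]_d :=
  invmx (spectralmx X) *m diag_mx (map_mx f (spectral_diag X)) *m spectralmx X.

(* On nonnegative reals, [n.-root] is the nonnegative real n-th root, so for X
   positive semidefinite this is the positive semidefinite X^(1/n). *)
Definition mxroot (n : nat) X : 'M[C]_d := mxfun n.-root X.

Definition absmx A : 'M[C]_d := mxroot 2 (A^t* *m A).

Definition maxabsmx A : 'M[C]_d :=
  lim (mxroot n (absmx A ^+ n + absmx (A^t*) ^+ n) @[n --> \oo]).

Definition geomean_pd X Y : 'M[C]_d :=
  let X2 := mxroot 2 X in
  X2 *m mxroot 2 (invmx X2 *m Y *m invmx X2) *m X2.

(* The filter [0^'+] is on C: [0 < e] entails that e is real, so this is the
   limit along positive reals. *)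
Definition geomean X Y : 'M[C]_d :=
  lim (geomean_pd (X + e%:M) (Y + e%:M) @[e --> (0 : C)^'+]).

End MatrixModulus.

(* Main.v *)
Require Import Defs.
From HB Require Import structures.
From mathcomp Require Import all_boot all_order all_algebra.
From mathcomp Require Import complex zify ring.
From mathcomp Require Import all_classical all_reals all_analysis.

Set Implicit Arguments.
Unset Strict Implicit.
Unset Printing Implicit Defensive.

Import Order.TTheory GRing.Theory Num.Theory.
Import numFieldNormedType.Exports.

Local Open Scope ring_scope.
Local Open Scope sesquilinear_scope.

(** The matrix [[|A^*|, A], [A^*, |A|]] is positive semidefinite, and both
    diagonal entries lie below the maximal modulus of A; summing over k gives
    [[S, B], [B^*, S]] >= 0 with B = sum A_k and S = sum |A_k|_v.  If B = U |B|
    is a polar decomposition with U unitary, conjugating by diag(U, 1) yields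
    [[U^* S U, |B|], [|B|, S]] >= 0, and the maximality of the geometric mean
    gives |B| <= S # (U^* S U).

    Two limits have to be shown to exist.  The geometric mean of X + e and
    Y + e is monotone in e, again by maximality.  For Kato's formula, the
    Loewner-Heinz inequality shows that X_n = (|A|^n + |A^*|^n)^(1/n) satisfies
    |A|, |A^*| <= X_n and X_k <= (1 + 1/k) X_n for k <= n, so that the bounded
    sequences u^* X_n u converge. *)

(** * Positive semidefinite matrices and the Loewner order *)

Section Psd.
Variable C : numClosedFieldType.

Lemma adjmxM m n p (A : 'M[C]_(m, n)) (B : 'M[C]_(n, p)) :
  (A *m B)^t* = B^t* *m A^t*.
Proof. by rewrite trmx_mul map_mxM. Qed.

Lemma adjmxD m n (A B : 'M[C]_(m, n)) : (A + B)^t* = A^t* + B^t*.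
Proof. by rewrite !raddfD. Qed.

Lemma adjmxN m n (A : 'M[C]_(m, n)) : (- A)^t* = - A^t*.
Proof. by rewrite !raddfN. Qed.

Lemma adjmxZ m n a (A : 'M[C]_(m, n)) : (a *: A)^t* = a^* *: A^t*.
Proof. by rewrite linearZ map_mxZ. Qed.

Lemma adjmx_scalar n (a : C) : (a%:M : 'M[C]_n)^t* = (a^*)%:M.
Proof. by rewrite tr_scalar_mx map_scalar_mx. Qed.

Lemma gram_ge0 n (u : 'cV[C]_n) : 0 <= (u^t* *m u) 0 0.
Proof.
rewrite !mxE sumr_ge0// => i _; rewrite !mxE mulrC; exact: mul_conjC_ge0.
Qed.

Lemma gram_eq0 n (u : 'cV[C]_n) : ((u^t* *m u) 0 0 == 0) = (u == 0).
Proof.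
apply/idP/eqP => [|->]; last by rewrite mulmx0 mxE.
rewrite !mxE psumr_eq0 => [/allP u0|i _]; last first.
  by rewrite !mxE mulrC mul_conjC_ge0.
apply/colP => i; rewrite mxE; have := u0 i (mem_index_enum i).
by rewrite !mxE mulf_eq0 conjC_eq0 orbb => /eqP.
Qed.

Lemma gram_mx_eq0 m n (A : 'M[C]_(m, n)) : A^t* *m A = 0 -> A = 0.
Proof.
move=> A0; apply/matrixP => i j; have: col j A == 0.
  rewrite -gram_eq0; apply/eqP; have /matrixP/(_ j j) := A0; rewrite !mxE => E.
  by rewrite -[RHS]E; apply: eq_bigr => k _; rewrite !mxE.
by move=> /eqP/colP/(_ i); rewrite !mxE.
Qed.

Lemma psdmx_adj d (X : 'M[C]_d) : psdmx X -> X^t* = X.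
Proof. by case=> /is_hermitianmxP XE _; rewrite [RHS]XE expr0 scale1r. Qed.

Lemma psdmx_ge0 d (X : 'M[C]_d) (u : 'cV_d) :
  psdmx X -> 0 <= (u^t* *m X *m u) 0 0.
Proof. by case. Qed.

Lemma psdmxI d (X : 'M[C]_d) : X^t* = X ->
  (forall u : 'cV[C]_d, 0 <= (u^t* *m X *m u) 0 0) -> psdmx X.
Proof.
by move=> XE X0; split=> //; apply/is_hermitianmxP; rewrite expr0 scale1r.
Qed.

Lemma psdmxD d (X Y : 'M[C]_d) : psdmx X -> psdmx Y -> psdmx (X + Y).
Proof.
move=> X0 Y0; apply: psdmxI => [|u]; first by rewrite adjmxD !psdmx_adj.
by rewrite mulmxDr mulmxDl mxE addr_ge0// psdmx_ge0.
Qed.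

Lemma psdmxZ d a (X : 'M[C]_d) : 0 <= a -> psdmx X -> psdmx (a *: X).
Proof.
move=> a0 X0; apply: psdmxI => [|u].
  by rewrite adjmxZ psdmx_adj// geC0_conj.
by rewrite -scalemxAr -scalemxAl mxE mulr_ge0// psdmx_ge0.
Qed.

Lemma psdmx_congr d p (X : 'M[C]_d) (W : 'M[C]_(d, p)) :
  psdmx X -> psdmx (W^t* *m X *m W).
Proof.
move=> X0; apply: psdmxI => [|u].
  by rewrite !adjmxM trmxCK psdmx_adj// mulmxA.
rewrite (_ : _ *m u = (W *m u)^t* *m X *m (W *m u)) ?psdmx_ge0//.
by rewrite adjmxM !mulmxA.
Qed.

Lemma psdmx_scalar d (a : C) : 0 <= a -> psdmx (a%:M : 'M[C]_d).
Proof.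
move=> a0; apply: psdmxI => [|u]; first by rewrite adjmx_scalar geC0_conj.
by rewrite scalar_mxC mul_scalar_mx -scalemxAl mxE mulr_ge0 ?gram_ge0.
Qed.

Lemma psdmx0 d : psdmx (0 : 'M[C]_d).
Proof. by rewrite -[0](raddf0 (@scalar_mx C d)); exact: psdmx_scalar. Qed.

Lemma psdmx1 d : psdmx (1%:M : 'M[C]_d).
Proof. exact: psdmx_scalar. Qed.

Lemma psdmx_gram d p (W : 'M[C]_(d, p)) : psdmx (W^t* *m W).
Proof. by rewrite -[W^t*]mulmx1; apply/psdmx_congr/psdmx1. Qed.

Lemma psdmx_sum d (I : Type) (r : seq I) (P : pred I) (X : I -> 'M[C]_d) :
  (forall i, P i -> psdmx (X i)) -> psdmx (\sum_(i <- r | P i) X i).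
Proof. by move=> X0; elim/big_ind: _; [exact: psdmx0|exact: psdmxD|]. Qed.

Lemma loewner_le_trans d (X Y Z : 'M[C]_d) :
  loewner_le X Y -> loewner_le Y Z -> loewner_le X Z.
Proof.
move=> XY YZ; rewrite /loewner_le.
rewrite (_ : Z - X = (Z - Y) + (Y - X)); first exact: psdmxD.
by rewrite addrA subrK.
Qed.

Lemma loewner_le_refl d (X : 'M[C]_d) : loewner_le X X.
Proof. by rewrite /loewner_le subrr; exact: psdmx0. Qed.

Lemma psdmx_diag d (D : 'rV[C]_d) :
  (forall i, 0 <= D 0 i) -> psdmx (diag_mx D).
Proof.
move=> D0; apply: psdmxI => [|u].
  rewrite tr_diag_mx map_diag_mx; congr diag_mx; apply/rowP => i.
  by rewrite mxE; exact: geC0_conj.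
rewrite mxE sumr_ge0// => i _; rewrite mul_mx_diag !mxE mulrAC mulr_ge0//.
by rewrite mulrC mul_conjC_ge0.
Qed.

Lemma psdmx_diag_ge0 d (D : 'rV[C]_d) i : psdmx (diag_mx D) -> 0 <= D 0 i.
Proof.
move=> D0; have := psdmx_ge0 (delta_mx i 0) D0.
rewrite mul_mx_diag mxE (bigD1 i)//= !mxE !eqxx.
rewrite conjC1 mul1r mulr1 big1 ?addr0// => j /negPf ji.
by rewrite !mxE ji mulr0.
Qed.

Lemma spectral_eq d (X : 'M[C]_d) : X^t* = X ->
  X = (spectralmx X)^t* *m diag_mx (spectral_diag X) *m spectralmx X.
Proof.
move=> XE; rewrite -invmx_unitary ?spectral_unitarymx//.
by apply/orthomx_spectralP/normalmxP; rewrite XE.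
Qed.

Lemma unitarymxVt d (P : 'M[C]_d) : P \is unitarymx -> P^t* *m P = 1%:M.
Proof. by move=> P1; rewrite -invmx_unitary// mulVmx// unitarymx_unit. Qed.

Lemma spectral_diag_mxE d (X : 'M[C]_d) : X^t* = X ->
  diag_mx (spectral_diag X) = spectralmx X *m X *m (spectralmx X)^t*.
Proof.
move=> XE; rewrite [X in _ = _ *m X *m _]spectral_eq// !mulmxA.
have /unitarymxP PE := spectral_unitarymx X.
by rewrite PE mul1mx -mulmxA PE mulmx1.
Qed.

Lemma spectral_diag_ge0 d (X : 'M[C]_d) i : psdmx X -> 0 <= spectral_diag X 0 i.
Proof.
move=> X0; have : psdmx (diag_mx (spectral_diag X)).
  rewrite (spectral_diag_mxE (psdmx_adj X0)).
  by have := psdmx_congr ((spectralmx X)^t*) X0; rewrite trmxCK.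
exact: psdmx_diag_ge0.
Qed.

(** A negative entry of [spectral_diag X] would have a nonzero eigenvector, namely a column of the
    adjoint of [spectralmx X]. *)
Lemma hermmx_eig_psd d (X : 'M[C]_d) : X^t* = X ->
  (forall (v : 'cV[C]_d) l, l < 0 -> X *m v = l *: v -> v = 0) -> psdmx X.
Proof.
move=> XE Xeig; rewrite (spectral_eq XE).
apply/psdmx_congr/psdmx_diag => i.
have /mxOverP/(_ 0 i) Dr : spectral_diag X \is a mxOver Num.real.
  apply: hermitian_spectral_diag_real; apply/is_hermitianmxP.
  by rewrite expr0 scale1r.
rewrite real_leNgt ?real0//; apply/negP => Dlt.
have /unitarymxP PE := spectral_unitarymx X.
pose v : 'cV_d := (spectralmx X)^t* *m delta_mx i 0.
have /(congr1 (mulmx (spectralmx X))) : v = 0.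
  apply: (Xeig v _ Dlt); rewrite [X in X *m _]spectral_eq// /v scalemxAr.
  rewrite -!mulmxA; congr (_ *m _); rewrite (mulmxA (spectralmx X)) PE mul1mx.
  apply/colP => j; rewrite mul_diag_mx !mxE.
  by case: eqVneq => [->|]; rewrite ?mulr0.
rewrite /v mulmxA PE mul1mx mulmx0 => /matrixP/(_ i 0)/eqP.
by rewrite !mxE !eqxx oner_eq0.
Qed.

(* If (S - K) v = l v with l < 0, then
   v^* (S^2 - K^2) v = 2 l v^* S v - l^2 v^* v, which forces v = 0. *)
Lemma loewner_le_sqr d (S K : 'M[C]_d) : psdmx S -> K^t* = K ->
  loewner_le (K *m K) (S *m S) -> loewner_le K S.
Proof.
move=> S0 KE SK; apply: hermmx_eig_psd => [|v l l0 SKv].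
  by rewrite adjmxD adjmxN KE psdmx_adj.
have Kv : K *m v = S *m v - l *: v.
  by rewrite -SKv mulmxBl opprB addrCA subrr addr0.
have lr : l^* = l by apply/CrealP/ltr0_real.
have SE := psdmx_adj S0.
have E : v^t* *m (S *m S - K *m K) *m v =
    l *: (v^t* *m S *m v) *+ 2 - l ^+ 2 *: (v^t* *m v).
  have Kv' : v^t* *m K = v^t* *m S - l *: v^t*.
    by rewrite -[X in _ *m X = _]KE -adjmxM Kv adjmxD adjmxN adjmxZ adjmxM lr SE.
  rewrite mulmxBr mulmxBl !mulmxA Kv' -!(mulmxA (_ - _)) Kv.
  rewrite mulmxBl !mulmxBr -!scalemxAl -!scalemxAr !mulmxA scalerA -expr2.
  have zE (V : zmodType) (a b c : V) : a - (a - b - (b - c)) = b *+ 2 - c.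
    by rewrite opprB (opprB a b) addrC addrA subrK mulr2n addrAC.
  exact: zE.
move: (psdmx_ge0 v SK); rewrite E; apply: contraTeq; rewrite -gram_eq0.
move: (gram_ge0 v) (psdmx_ge0 v S0).
move: (v^t* *m S *m v) (v^t* *m v) => Q N N0 Q0 NN0; rewrite !mxE.
rewrite lt_geF// subr_lt0 (@le_lt_trans _ _ 0)//.
  by rewrite -mulr2n mulrn_wle0// nmulr_rle0.
apply: mulr_gt0; last by rewrite lt_def NN0.
by rewrite -sqrrN exprn_gt0// oppr_gt0.
Qed.
(** The eigenvalues of Y - X and their opposites are all nonnegative, so they vanish. *)
Lemma loewner_le_anti d (X Y : 'M[C]_d) :
  loewner_le X Y -> loewner_le Y X -> X = Y.
Proof.
move=> XY YX; apply/eqP; rewrite eq_sym -subr_eq0; apply/eqP.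
have E := spectral_eq (psdmx_adj XY).
rewrite E (_ : spectral_diag _ = 0) ?raddf0 ?mulmx0 ?mul0mx//.
apply/rowP => i; rewrite [RHS]mxE; apply/le_anti.
rewrite spectral_diag_ge0// andbT -oppr_ge0.
have /psdmx_diag_ge0 : psdmx (diag_mx (- spectral_diag (Y - X))).
  rewrite raddfN/= (spectral_diag_mxE (psdmx_adj XY)) -mulNmx -mulmxN opprB.
  by have := psdmx_congr ((spectralmx (Y - X))^t*) YX; rewrite trmxCK.
by move=> /(_ i); rewrite mxE.
Qed.

(** * Powers, roots and the modulus through diagonalization *)

Lemma conj_diag_exp d (P : 'M[C]_d) (D : 'rV[C]_d) n : P \is unitarymx ->
  (P^t* *m diag_mx D *m P) ^+ n =
  P^t* *m diag_mx (map_mx (fun x => x ^+ n) D) *m P.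
Proof.
move=> P1; have /unitarymxP PE := P1; elim: n => [|n IHn].
  rewrite expr0 -[LHS](unitarymxVt P1); congr (_ *m _).
  rewrite -[LHS]mulmx1; congr (_ *m _); apply/matrixP => i j.
  by rewrite !mxE expr0.
rewrite exprS IHn -mulmxE !mulmxA -(mulmxA _ P) PE mulmx1; congr (_ *m _).
rewrite -!mulmxA mulmx_diag; congr (_ *m diag_mx _); apply/rowP => i.
by rewrite !mxE exprS.
Qed.

Lemma mxroot_psd d n (X : 'M[C]_d) : (0 < n)%N -> psdmx X -> psdmx (mxroot n X).
Proof.
move=> n0 X0; rewrite /mxroot /mxfun invmx_unitary ?spectral_unitarymx//.
by apply/psdmx_congr/psdmx_diag => i; rewrite mxE rootC_ge0 ?spectral_diag_ge0.
Qed.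

Lemma mxrootK d n (X : 'M[C]_d) : (0 < n)%N -> psdmx X -> mxroot n X ^+ n = X.
Proof.
move=> n0 X0; rewrite /mxroot /mxfun invmx_unitary ?spectral_unitarymx//.
rewrite conj_diag_exp ?spectral_unitarymx// [RHS](spectral_eq (psdmx_adj X0)).
by congr (_ *m diag_mx _ *m _); apply/rowP => i; rewrite !mxE rootCK.
Qed.

Lemma mxsqrtK d (X : 'M[C]_d) : psdmx X -> mxroot 2 X *m mxroot 2 X = X.
Proof. by move=> X0; rewrite -[RHS](@mxrootK _ 2)// expr2 mulmxE. Qed.

Lemma psdmx_exp d (X : 'M[C]_d) n : psdmx X -> psdmx (X ^+ n).
Proof.
move=> X0; rewrite (spectral_eq (psdmx_adj X0)).
rewrite conj_diag_exp ?spectral_unitarymx//; apply/psdmx_congr/psdmx_diag => i.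
by rewrite mxE exprn_ge0// spectral_diag_ge0.
Qed.

Lemma absmx_psd d (A : 'M[C]_d) : psdmx (absmx A).
Proof. exact/mxroot_psd/psdmx_gram. Qed.

Lemma absmx_sqr d (A : 'M[C]_d) : absmx A *m absmx A = A^t* *m A.
Proof. exact/mxsqrtK/psdmx_gram. Qed.

(** Monotonicity of the square root is applied in both directions. *)
Lemma sqrmx_inj d (S T : 'M[C]_d) : psdmx S -> psdmx T ->
  S *m S = T *m T -> S = T.
Proof.
move=> S0 T0 E; apply: loewner_le_anti.
  by apply: loewner_le_sqr (psdmx_adj S0) _ => //; rewrite E; exact: loewner_le_refl.
by apply: loewner_le_sqr (psdmx_adj T0) _ => //; rewrite E; exact: loewner_le_refl.
Qed.

(** A nonzero v in the left kernel would contradict v (X + e) v^* >= e |v|^2 > 0. *)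
Lemma unitmx_add_scalar d (X : 'M[C]_d) e : psdmx X -> 0 < e ->
  X + e%:M \in unitmx.
Proof.
move=> X0 e0; rewrite unitmxE unitfE; apply/negP => /det0P[v vn0 vX].
have : 0 < (v *m (X + e%:M) *m v^t*) 0 0.
  rewrite mulmxDr mulmxDl mxE -[v in v *m X]trmxCK -[v in v *m e%:M]trmxCK.
  rewrite ltr_wpDl ?psdmx_ge0//.
  rewrite mul_mx_scalar -scalemxAl mxE mulr_gt0// lt_def gram_ge0 gram_eq0 andbT.
  apply: contraNneq vn0 => /(congr1 (fun X => X^t*)).
  by rewrite trmxCK trmx0 map_mx0 => ->.
by rewrite vX mul0mx mxE ltxx.
Qed.

Lemma psdmx_add_scalar d (X : 'M[C]_d) e :
  psdmx X -> 0 <= e -> psdmx (X + e%:M).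
Proof. by move=> X0 e0; apply: psdmxD => //; exact: psdmx_scalar. Qed.

(** * Block matrices and the geometric mean *)

(** This is positivity of the block matrix [[P, H], [H^*, Q]], with its quadratic form at (x, y)
    expanded so that no matrix of size d + d is formed. *)
Definition block_psd d (P H Q : 'M[C]_d) := forall x y : 'cV[C]_d,
  0 <= (x^t* *m P *m x + x^t* *m H *m y
        + (y^t* *m H^t* *m x + y^t* *m Q *m y)) 0 0.

(** The form is evaluated at its minimizer in x, which is - P^-1 H y; what remains is the Schur
    complement Q - H P^-1 H at y. *)
Lemma block_psd_schur d (P H Q : 'M[C]_d) :
  psdmx P -> P \in unitmx -> H^t* = H -> psdmx Q ->
  block_psd P H Q -> loewner_le (H *m invmx P *m H) Q.
Proof.
move=> P0 P1 HE Q0 PHQ.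
have PE := psdmx_adj P0.
have VE : (invmx P)^t* = invmx P by rewrite trmx_inv map_invmx PE.
apply: psdmxI => [|y].
  by rewrite adjmxD adjmxN !adjmxM VE HE (psdmx_adj Q0) mulmxA.
have := PHQ (- (invmx P *m H *m y)) y.
rewrite adjmxN !adjmxM VE HE !(mulNmx, mulmxN) opprK !mulmxA.
by rewrite (mulmxKV P1) subrr add0r addrC mulmxBr mulmxBl !mulmxA.
Qed.

(** The form is the squared norm of Z x + S Z y. With Z = P^(1/2) this makes the geometric mean
    itself an admissible off-diagonal block. *)
Lemma block_psd_factor d (Z S : 'M[C]_d) : Z^t* = Z -> S^t* = S ->
  block_psd (Z *m Z) (Z *m S *m Z) (Z *m (S *m S) *m Z).
Proof.
move=> ZE SE x y; rewrite (_ : _ + _ =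
    (Z *m x + S *m Z *m y)^t* *m (Z *m x + S *m Z *m y)) ?gram_ge0//.
by rewrite adjmxD !adjmxM ZE SE mulmxDl !mulmxDr !mulmxA.
Qed.

(** Put K = Z^-1 H Z^-1. The Schur complement, conjugated by Z^-1, says K^2 <= S^2; hence K <= S,
    and conjugating by Z gives the claim. *)
Lemma block_psd_max d (Z S Q H : 'M[C]_d) :
  psdmx Z -> Z \in unitmx -> psdmx S -> psdmx Q ->
  S *m S = invmx Z *m Q *m invmx Z ->
  H^t* = H -> block_psd (Z *m Z) H Q -> loewner_le H (Z *m S *m Z).
Proof.
move=> Z0 Z1 S0 Q0 SS HE PHQ; have ZE := psdmx_adj Z0.
have VE : (invmx Z)^t* = invmx Z by rewrite trmx_inv map_invmx ZE.
have ZZ0 : psdmx (Z *m Z) by rewrite -[X in X *m _]ZE; exact: psdmx_gram.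
have ZZ1 : Z *m Z \in unitmx by rewrite unitmx_mul Z1.
have ZZV : invmx (Z *m Z) = invmx Z *m invmx Z.
  rewrite -[RHS]mulmx1 -(mulmxV ZZ1) !mulmxA (mulmxKV Z1).
  by rewrite mulVmx// mul1mx.
have KS : loewner_le (invmx Z *m H *m invmx Z) S.
  apply: loewner_le_sqr => //; first by rewrite !adjmxM VE HE mulmxA.
  have := psdmx_congr (invmx Z) (block_psd_schur ZZ0 ZZ1 HE Q0 PHQ).
  by rewrite SS VE ZZV mulmxBr mulmxBl !mulmxA.
have := psdmx_congr Z KS; rewrite ZE mulmxBr mulmxBl !mulmxA mulmxV// mul1mx.
by rewrite mulmxKV.
Qed.

Lemma mxsqrt_unit d (P : 'M[C]_d) :
  psdmx P -> P \in unitmx -> mxroot 2 P \in unitmx.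
Proof. by move=> P0; rewrite -{1}(mxsqrtK P0) unitmx_mul => /andP[]. Qed.

Lemma psdmx_congr_inv d (Z Q : 'M[C]_d) :
  psdmx Z -> psdmx Q -> psdmx (invmx Z *m Q *m invmx Z).
Proof.
move=> Z0 Q0; have := psdmx_congr (invmx Z) Q0.
by rewrite trmx_inv map_invmx (psdmx_adj Z0).
Qed.

Lemma congr_invK d (Z Q : 'M[C]_d) :
  Z \in unitmx -> Z *m (invmx Z *m Q *m invmx Z) *m Z = Q.
Proof. by move=> Z1; rewrite !mulmxA mulmxV// mul1mx mulmxKV. Qed.

Section Geomean.
Variables (d : nat) (P Q : 'M[C]_d).
Hypotheses (P0 : psdmx P) (P1 : P \in unitmx) (Q0 : psdmx Q).

Let Z0 : psdmx (mxroot 2 P). Proof. exact: mxroot_psd. Qed.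
Let T0 := psdmx_congr_inv Z0 Q0.

Lemma geomean_pd_psd : psdmx (geomean_pd P Q).
Proof.
have := psdmx_congr (mxroot 2 P) (mxroot_psd (isT : 0 < 2)%N T0).
by rewrite (psdmx_adj Z0).
Qed.

Lemma geomean_pd_block : block_psd P (geomean_pd P Q) Q.
Proof.
have := @block_psd_factor _ (mxroot 2 P)
  (mxroot 2 (invmx (mxroot 2 P) *m Q *m invmx (mxroot 2 P))).
by rewrite (mxsqrtK T0) (mxsqrtK P0) (congr_invK _ (mxsqrt_unit P0 P1)); apply;
  exact/psdmx_adj/mxroot_psd.
Qed.

Lemma geomean_pd_max H : H^t* = H -> block_psd P H Q ->
  loewner_le H (geomean_pd P Q).
Proof.
move=> HE PHQ; apply: (block_psd_max Z0 _ _ Q0) => //.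
- exact: mxsqrt_unit.
- exact: mxroot_psd.
- exact: mxsqrtK.
- by rewrite mxsqrtK.
Qed.
End Geomean.

Lemma block_psd_le d (P P' H Q Q' : 'M[C]_d) :
  loewner_le P P' -> loewner_le Q Q' -> block_psd P H Q -> block_psd P' H Q'.
Proof.
move=> PP QQ PHQ x y; have := PHQ x y.
have mxD (M N : 'M[C]_1) : M 0 0 + N 0 0 = (M + N) 0 0 by rewrite mxE.
move=> /(addr_ge0 (addr_ge0 (psdmx_ge0 x PP) (psdmx_ge0 y QQ))).
rewrite !mxD; congr (0 <= fun_of_matrix _ 0 0).
rewrite !mulmxBr !mulmxBl.
by rewrite addrACA (addrA (_ - _)) subrK (addrCA (_ - _)) subrK.
Qed.

(** The form is that of Y^m at the vector x + Y y. *)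
Lemma block_psd_exp d (Y : 'M[C]_d) m : psdmx Y ->
  block_psd (Y ^+ m) (Y ^+ m.+1) (Y ^+ m.+2).
Proof.
move=> Y0 x y; have YE := psdmx_adj Y0; have YmE := psdmx_adj (psdmx_exp m Y0).
have -> : Y ^+ m.+2 = Y *m Y ^+ m *m Y by rewrite exprS exprSr !mulmxE mulrA.
rewrite (_ : _ + _ = (x + Y *m y)^t* *m Y ^+ m *m (x + Y *m y)).
  exact/psdmx_ge0/psdmx_exp.
rewrite (psdmx_adj (psdmx_exp m.+1 Y0)) adjmxD adjmxM YE.
rewrite !mulmxDr !mulmxDl !mulmxA -addrA -addrA; congr (_ + _).
rewrite addrCA; congr (_ + _); last congr (_ + _).
  by rewrite exprS -mulmxE !mulmxA.
by rewrite exprSr -mulmxE !mulmxA.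
Qed.

(** * The Loewner-Heinz inequality *)

Lemma unitmx_exp d (Z : 'M[C]_d) n : Z \in unitmx -> Z ^+ n \in unitmx.
Proof.
move=> Z1; elim: n => [|n IHn]; first by rewrite expr0 unitmx1.
by rewrite exprS -mulmxE unitmx_mul Z1.
Qed.

(* The block matrix [X^m, Y^(m+1); Y^(m+1), X^(m+2)] dominates
   [Y^m, Y^(m+1); Y^(m+1), Y^(m+2)] >= 0, so Y^(m+1) is below the geometric
   mean of the diagonal, namely X^(m+1). *)
Lemma loewner_le_exp_logconvex d (Z Y : 'M[C]_d) m (a b : C) :
  psdmx Z -> Z \in unitmx -> psdmx Y -> 0 < a -> 0 < b ->
  loewner_le (Y ^+ m) (a ^+ 2 *: (Z ^+ m *m Z ^+ m)) ->
  loewner_le (Y ^+ m.+2) (b ^+ 2 *: (Z ^+ m.+2 *m Z ^+ m.+2)) ->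
  loewner_le (Y ^+ m.+1) ((a * b) *: (Z ^+ m.+1 *m Z ^+ m.+1)).
Proof.
move=> Z0 Z1 Y0 a0 b0 Ya Yb.
have blk := block_psd_le Ya Yb (block_psd_exp m Y0).
(* Chosen so that the diagonal blocks are V V and V S S V; their geometric mean V S V is then the
   required bound. *)
pose V := a *: Z ^+ m; pose S := (b / a) *: (Z *m Z).
have V0 : psdmx V by apply: psdmxZ (ltW a0) _; exact: psdmx_exp.
have V1 : V \in unitmx by rewrite unitmxZ ?unitfE ?gt_eqF ?unitmx_exp.
have S0 : psdmx S.
  apply: psdmxZ; first by rewrite ltW// divr_gt0.
  by rewrite -[X in X *m _](psdmx_adj Z0); exact: psdmx_gram.
have Q0 : psdmx (b ^+ 2 *: (Z ^+ m.+2 *m Z ^+ m.+2)).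
  apply: psdmxZ; first by rewrite exprn_ge0// ltW.
  rewrite -[X in X *m _](psdmx_adj (psdmx_exp m.+2 Z0)); exact: psdmx_gram.
have VE : V *m V = a ^+ 2 *: (Z ^+ m *m Z ^+ m).
  by rewrite /V -scalemxAl -scalemxAr scalerA -expr2.
have QE : b ^+ 2 *: (Z ^+ m.+2 *m Z ^+ m.+2) = V *m (S *m S) *m V.
  rewrite /V /S !(=^~scalemxAl, =^~scalemxAr, scalerA).
  congr (_ *: _); first by field; rewrite gt_eqF.
  by rewrite !mulmxE -[Z * Z]expr2 -!exprD; congr (_ ^+ _); lia.
have := block_psd_max V0 V1 S0 Q0 _ (psdmx_adj (psdmx_exp m.+1 Y0)).
rewrite VE => /(_ _ blk).
have -> : V *m S *m V = (a * b) *: (Z ^+ m.+1 *m Z ^+ m.+1).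
  rewrite /V /S !(=^~scalemxAl, =^~scalemxAr, scalerA).
  congr (_ *: _); first by field; rewrite gt_eqF.
  by rewrite !mulmxE -[Z * Z]expr2 -!exprD; congr (_ ^+ _); lia.
apply; rewrite QE !mulmxA mulVmx// mul1mx mulmxK//.
Qed.

(** The order of [C] is partial, whence the reality assumption. The extra entry 1 covers the empty
    list and gives a maximum at least 1. *)
Lemma real_seq_max (s : seq C) : (forall x, x \in s -> x \is Num.real) ->
  exists2 a, a \in 1 :: s & forall x, x \in 1 :: s -> x <= a.
Proof.
elim: s => [|x s IHs] sr.
  by exists 1; rewrite ?inE// => x; rewrite inE => /eqP ->.
have [y ys|a a1 amax] := IHs; first by apply: sr; rewrite inE ys orbT.
have ar : a \is Num.real.
  move: a1; rewrite inE => /orP[/eqP -> //|a1].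
  by apply: sr; rewrite inE a1 orbT.
have xr : x \is Num.real by apply: sr; rewrite mem_head.
have [ax|xa] := real_leP ar xr.
  exists x => [|y]; first by rewrite !inE eqxx orbT.
  rewrite !inE orbCA => /orP[/eqP -> //|ys].
  by apply: le_trans (amax _ _) ax; rewrite inE.
exists a => [|y]; first by move: a1; rewrite !inE => /orP[->|->]; rewrite ?orbT.
rewrite !inE orbCA => /orP[/eqP -> //|ys]; first exact: ltW.
by apply: amax; rewrite inE.
Qed.

(** The constant is the maximum of 1 and the eigenvalues of T; the floor 1 keeps it positive even
    for T = 0. *)
Lemma loewner_scalar_min d (T : 'M[C]_d) : psdmx T ->
  exists a, [/\ 1 <= a, loewner_le T a%:M &
    forall b, 1 <= b -> loewner_le T b%:M -> a <= b].
Proof.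
move=> T0; have TE := psdmx_adj T0; set P := spectralmx T.
have P1 : P \is unitarymx := spectral_unitarymx T.
pose s := [seq spectral_diag T 0 i | i : 'I_d].
have scE b : b%:M - T = P^t* *m diag_mx (const_mx b - spectral_diag T) *m P.
  rewrite raddfB/= mulmxBr mulmxBl -spectral_eq// diag_const_mx.
  by rewrite mul_mx_scalar -scalemxAl unitarymxVt// scalemx1.
have [x|a a1 amax] := @real_seq_max s.
  by case/mapP => i _ ->; apply/ger0_real/spectral_diag_ge0.
exists a; split; first by apply: amax; rewrite mem_head.
  rewrite /loewner_le scE; apply/psdmx_congr/psdmx_diag => i.
  rewrite !mxE subr_ge0; apply: amax; rewrite inE; apply/orP; right.
  by apply: map_f; rewrite mem_enum.
move=> b b1 Tb; move: a1; rewrite inE => /orP[/eqP -> //|/mapP[i _ ->]].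
have := psdmx_congr (P^t*) Tb; rewrite trmxCK scE !mulmxA.
have /unitarymxP PE := P1; rewrite PE mul1mx -mulmxA PE mulmx1.
by move=> /psdmx_diag_ge0 => /(_ i); rewrite !mxE subr_ge0.
Qed.

(** Congruence by V^-1 turns V V into the identity and reduces to the scalar case. *)
Lemma loewner_pencil_min d (V W : 'M[C]_d) :
  psdmx V -> V \in unitmx -> psdmx W ->
  exists a, [/\ 1 <= a, loewner_le W (a *: (V *m V)) &
    forall b, 1 <= b -> loewner_le W (b *: (V *m V)) -> a <= b].
Proof.
move=> V0 V1 W0; have VE := psdmx_adj V0.
have [a [a1 aW amin]] := loewner_scalar_min (psdmx_congr_inv V0 W0).
exists a; split=> // [|b b1 bW].
  have := psdmx_congr V aW; rewrite VE mulmxBr mulmxBl congr_invK//.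
  by rewrite mul_mx_scalar -scalemxAl.
apply: amin => //; have := psdmx_congr_inv V0 bW.
rewrite mulmxBr mulmxBl -scalemxAr -scalemxAl !mulmxA mulVmx// mul1mx mulmxV//.
by rewrite scalemx1.
Qed.

(** The sequence increases up to n: if a_i <= a_(i+1), then a_(i+1)^2 <= a_i a_(i+2) <= a_(i+1)
    a_(i+2). It is thus squeezed between 1 and a_n = 1. *)
Lemma logconvex_le1 (a : nat -> C) n : (forall i, 1 <= a i) -> a 0%N = 1 ->
  a n = 1 -> (forall i, (i.+2 <= n)%N -> a i.+1 ^+ 2 <= a i * a i.+2) ->
  forall k, (k <= n)%N -> a k = 1.
Proof.
move=> a1 a0 an aconv.
have agt i : 0 < a i by apply: lt_le_trans (a1 i).
have amono i : (i < n)%N -> a i <= a i.+1.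
  elim: i => [|i IHi] lin; first by rewrite a0.
  rewrite -(ler_pM2l (agt i.+1)) -expr2 (le_trans (aconv i lin))//.
  by rewrite ler_pM2r// IHi// ltnW.
move=> k kn; apply/le_anti; rewrite a1 andbT -an.
elim: n kn amono {aconv an} => [|n IHn]; first by rewrite leqn0 => /eqP ->.
rewrite leq_eqVlt ltnS => /orP[/eqP -> //|kn] amono.
apply: le_trans (IHn kn _) (amono n _) => // i lin.
by apply: amono; rewrite ltnS ltnW.
Qed.

(* The least a_k >= 1 with Y^k <= a_k X^k, where X = Z^2, is log-convex in k. *)
Lemma loewner_heinz_unit d (Z Y : 'M[C]_d) n k :
  psdmx Z -> Z \in unitmx -> psdmx Y -> (k <= n)%N ->
  loewner_le (Y ^+ n) (Z ^+ n *m Z ^+ n) ->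
  loewner_le (Y ^+ k) (Z ^+ k *m Z ^+ k).
Proof.
move=> Z0 Z1 Y0 kn YZ.
have /boolp.choice[a aP] i := loewner_pencil_min (psdmx_exp i Z0)
  (unitmx_exp i Z1) (psdmx_exp i Y0).
have a1 i : 1 <= a i by have [] := aP i.
have agt i : 0 < a i by apply: lt_le_trans (a1 i).
suff ak : a k = 1 by have [_] := aP k; rewrite ak scale1r.
apply: (@logconvex_le1 a n) => // [||i lin].
- apply/le_anti; rewrite a1 andbT; have [_ _] := aP 0%N; apply=> //.
  rewrite scale1r !expr0 mulmxE mulr1; exact: loewner_le_refl.
- apply/le_anti; rewrite a1 andbT; have [_ _] := aP n; apply=> //.
  by rewrite scale1r.
(* This product is an admissible constant at i + 1, so the least one lies below it; squaring gives
   log-convexity. *)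
have [_ _ /(_ (sqrtC (a i) * sqrtC (a i.+2)))] := aP i.+1.
have s0 j : 0 < sqrtC (a j) by rewrite sqrtC_gt0.
move=> amin; rewrite -(@sqrtCK _ (a i)) -(@sqrtCK _ (a i.+2)) -exprMn.
have s1 j : 1 <= sqrtC (a j).
  by rewrite -(@rootC1 _ 2)// ler_rootC// qualifE/= ltW.
have p0 : 0 <= sqrtC (a i) * sqrtC (a i.+2) by rewrite mulr_ge0// ltW.
rewrite ler_pXn2r ?nnegrE ?(ltW (agt _))//; apply: amin; first exact: mulr_ege1.
apply: loewner_le_exp_logconvex => //; rewrite sqrtCK.
  by have [] := aP i.
by have [] := aP i.+2.
Qed.

(** The perturbation is removed without a limit: at a fixed vector the form is q + e r with r >= 0,
    and a suitable e rules out q < 0. *)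
Lemma psdmx_pert d (X : 'M[C]_d) (c : C) : 0 <= c -> X^t* = X ->
  (forall e, 0 < e -> e <= 1 -> psdmx (X + (e * c)%:M)) -> psdmx X.
Proof.
move=> c0 XE Xe; apply: psdmxI => // u.
pose q := (u^t* *m X *m u) 0 0; pose r := c * (u^t* *m u) 0 0.
have r0 : 0 <= r by rewrite mulr_ge0 ?gram_ge0.
have qe e : 0 < e -> e <= 1 -> 0 <= q + e * r.
  move=> e0 e1; have := psdmx_ge0 u (Xe e e0 e1).
  rewrite mulmxDr mulmxDl mul_mx_scalar -scalemxAl mxE [X in _ + X]mxE.
  by rewrite -mulrA.
have qr : q \is Num.real.
  rewrite -[q](addrK (1 * r)) rpredB// ger0_real ?qe ?mul1r//.
rewrite -/q real_leNgt ?real0//; apply/negP => q0.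
have w0 : 0 < r + 1 - q by rewrite -addrA ltr_wpDl// addr_gt0// oppr_gt0.
(* For q < 0 this e lies between 0 and 1 and gives q + e r = q (1 - q) / (r + 1 - q) < 0. *)
have := qe (- q / (r + 1 - q)).
rewrite divr_gt0 ?oppr_gt0// ler_pdivrMr// mul1r lerDr addr_ge0// => /(_ isT isT).
have -> : q + - q / (r + 1 - q) * r = q * ((1 - q) / (r + 1 - q)).
  by field; rewrite gt_eqF.
rewrite nmulr_rge0// => /le_gtF.
by rewrite divr_gt0// addr_gt0// oppr_gt0.
Qed.

(** The difference of powers factors through e; bounding x + e by x + 1 makes the other factor
    independent of e. *)
Lemma expr_pert_le (x e : C) k : 0 <= x -> 0 < e -> e <= 1 ->
  (x + e) ^+ k - x ^+ k <= e * \sum_(j < k) (x + 1) ^+ (k.-1 - j) * x ^+ j.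
Proof.
move=> x0 e0 e1; rewrite subrXX addrAC subrr add0r ler_pM2l//.
apply: ler_sum => j _; rewrite ler_wpM2r ?exprn_ge0//.
by rewrite lerXn2r ?nnegrE ?addr_ge0 ?lerD2l// ltW.
Qed.

(** The invertible case applies to X + e, and [psdmx_pert] removes e because (X + e)^k - X^k is at
    most e times a scalar independent of e. *)
Lemma loewner_heinz d (X Y : 'M[C]_d) n k :
  psdmx X -> psdmx Y -> (k <= n)%N ->
  loewner_le (Y ^+ n) (X ^+ n) -> loewner_le (Y ^+ k) (X ^+ k).
Proof.
move=> X0 Y0 kn YX; set P := spectralmx X; set D := spectral_diag X.
have P1 : P \is unitarymx := spectral_unitarymx X.
have D0 i : 0 <= D 0 i by exact: spectral_diag_ge0.
have XE : X = P^t* *m diag_mx D *m P by exact/spectral_eq/psdmx_adj.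
have XeE e : X + e%:M = P^t* *m diag_mx (D + const_mx e) *m P.
  rewrite raddfD/= mulmxDr mulmxDl -XE diag_const_mx.
  by rewrite mul_mx_scalar -scalemxAl unitarymxVt// scalemx1.
have expB e m : (X + e%:M) ^+ m - X ^+ m =
    P^t* *m diag_mx (\row_i ((D 0 i + e) ^+ m - D 0 i ^+ m)) *m P.
  rewrite XeE [X in _ - X ^+ m]XE !conj_diag_exp// -mulmxBl -mulmxBr -raddfB/=.
  by congr (_ *m diag_mx _ *m _); apply/rowP => i; rewrite !mxE.
pose g (x : C) := \sum_(j < k) (x + 1) ^+ (k.-1 - j) * x ^+ j.
have g0 x : 0 <= x -> 0 <= g x.
  by move=> x0; rewrite sumr_ge0// => j _; rewrite mulr_ge0 ?exprn_ge0 ?addr_ge0.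
apply: (@psdmx_pert _ _ (\sum_i g (D 0 i))) => [||e e0 e1].
- by rewrite sumr_ge0// => i _; exact: g0.
- by rewrite adjmxD adjmxN !psdmx_adj//; exact: psdmx_exp.
(* The first summand is handled by the invertible case, the second by comparing eigenvalues of X. *)
rewrite (_ : _ + _ = ((X + e%:M) ^+ k - Y ^+ k) +
    ((e * \sum_i g (D 0 i))%:M - ((X + e%:M) ^+ k - X ^+ k))); last first.
  have zE (V : zmodType) (a b y s : V) : a - y + s = b - y + (s - (b - a)).
    by rewrite opprB [RHS]addrCA (addrC (b - y)) (addrA (a - b)) subrK addrC.
  exact: zE.
apply: psdmxD; last first.
  rewrite expB (_ : _%:M =
    P^t* *m diag_mx (const_mx (e * \sum_i g (D 0 i))) *m P); last first.
    by rewrite diag_const_mx mul_mx_scalar -scalemxAl unitarymxVt// scalemx1.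
  rewrite -mulmxBl -mulmxBr -raddfB/=; apply/psdmx_congr/psdmx_diag => i.
  rewrite !mxE subr_ge0 (le_trans (expr_pert_le _ _ _ _))// ler_pM2l//.
  by rewrite [leRHS](bigD1 i)//= lerDl sumr_ge0// => j _; exact: g0.
have Xe0 := psdmx_add_scalar X0 (ltW e0); have Xe1 := unitmx_add_scalar X0 e0.
have ZE m :
    mxroot 2 (X + e%:M) ^+ m *m mxroot 2 (X + e%:M) ^+ m = (X + e%:M) ^+ m.
  by rewrite -[in RHS](mxsqrtK Xe0) !mulmxE -!expr2 -!exprM mulnC.
rewrite -ZE; apply: (loewner_heinz_unit _ _ Y0 kn).
- exact: mxroot_psd.
- exact: mxsqrt_unit.
rewrite ZE; apply: loewner_le_trans YX _; rewrite /loewner_le expB.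
apply/psdmx_congr/psdmx_diag => i; rewrite mxE subr_ge0.
by rewrite lerXn2r ?nnegrE ?lerDl ?addr_ge0// ltW.
Qed.

Lemma scalar_mx_exp d (a : C) n : (a%:M : 'M[C]_d) ^+ n = (a ^+ n)%:M.
Proof.
elim: n => [|n IHn]; first by rewrite !expr0.
by rewrite exprS IHn -mulmxE -scalar_mxM -exprS.
Qed.

Lemma scalemx_exp d (a : C) (X : 'M[C]_d) n : (a *: X) ^+ n = a ^+ n *: X ^+ n.
Proof.
elim: n => [|n IHn]; first by rewrite !expr0 scale1r.
by rewrite !exprS IHn -mulmxE -scalemxAl -scalemxAr scalerA.
Qed.

(** Powers are not Loewner monotone in general, but X commutes with the scalar b, so only
    eigenvalues are compared. *)
Lemma loewner_le_scalar_exp d (X : 'M[C]_d) (b : C) n : psdmx X -> 0 <= b ->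
  loewner_le X b%:M -> loewner_le (X ^+ n) (b ^+ n)%:M.
Proof.
move=> X0 b0 Xb; have XE := psdmx_adj X0; set P := spectralmx X.
have P1 : P \is unitarymx := spectral_unitarymx X.
have scE c (D : 'rV_d) : c%:M - P^t* *m diag_mx D *m P =
    P^t* *m diag_mx (const_mx c - D) *m P.
  rewrite raddfB/= mulmxBr mulmxBl diag_const_mx.
  by rewrite mul_mx_scalar -scalemxAl unitarymxVt// scalemx1.
have Db i : spectral_diag X 0 i <= b.
  have := psdmx_congr (P^t*) Xb; rewrite trmxCK [in X in psdmx X](spectral_eq XE).
  rewrite scE !mulmxA; have /unitarymxP PE := P1.
  rewrite PE mul1mx -mulmxA PE mulmx1.
  by move=> /psdmx_diag_ge0 => /(_ i); rewrite !mxE subr_ge0.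
rewrite /loewner_le (spectral_eq XE) conj_diag_exp// scE.
apply/psdmx_congr/psdmx_diag => i; rewrite !mxE subr_ge0.
by rewrite lerXn2r ?nnegrE ?spectral_diag_ge0.
Qed.

(** * Kato's sequence *)

Section Kato.
Variables (d : nat) (P Q : 'M[C]_d).
Hypotheses (P0 : psdmx P) (Q0 : psdmx Q).

Definition kato n := mxroot n (P ^+ n + Q ^+ n).

Let PQ0 n : psdmx (P ^+ n + Q ^+ n).
Proof. by apply: psdmxD; exact: psdmx_exp. Qed.

Lemma kato_psd n : (0 < n)%N -> psdmx (kato n).
Proof. by move=> n0; exact: mxroot_psd. Qed.

Lemma kato_exp n : (0 < n)%N -> kato n ^+ n = P ^+ n + Q ^+ n.
Proof. by move=> n0; exact: mxrootK. Qed.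

(** The n-th power P^n + Q^n dominates each summand; Loewner-Heinz lowers the exponent to k. *)
Lemma kato_exp_ge n k : (0 < n)%N -> (k <= n)%N ->
  loewner_le (P ^+ k) (kato n ^+ k) /\ loewner_le (Q ^+ k) (kato n ^+ k).
Proof.
move=> n0 kn; have X0 := kato_psd n0.
split; [apply: (loewner_heinz X0 P0 kn) | apply: (loewner_heinz X0 Q0 kn)].
  by rewrite kato_exp// /loewner_le addrAC subrr add0r; exact: psdmx_exp.
by rewrite kato_exp// /loewner_le addrK; exact: psdmx_exp.
Qed.

Lemma kato_ge n : (0 < n)%N -> loewner_le P (kato n) /\ loewner_le Q (kato n).
Proof. by move=> n0; have := kato_exp_ge n0 n0; rewrite !expr1. Qed.

(** With X_n for [kato n], X_k^k = P^k + Q^k <= 2 X_n^k <= (1 + 1/k)^k X_n^k, the last step by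
    Bernoulli; Loewner-Heinz lowers the exponent k to 1. *)
Lemma kato_almost_incr k n : (0 < k)%N -> (k <= n)%N ->
  loewner_le (kato k) ((1 + k%:R^-1) *: kato n).
Proof.
move=> k0 kn; have n0 : (0 < n)%N := leq_trans k0 kn.
have k1 : 0 <= 1 + k%:R^-1 :> C by rewrite addr_ge0// invr_ge0.
have [PX QX] := kato_exp_ge n0 kn.
rewrite -[kato k]expr1 -[_ *: _]expr1.
apply: (loewner_heinz (psdmxZ k1 (kato_psd n0)) (kato_psd k0) k0).
rewrite kato_exp// scalemx_exp.
apply: (@loewner_le_trans _ _ (2 *: kato n ^+ k)).
  rewrite /loewner_le scaler_nat mulr2n opprD addrACA; exact: psdmxD.
rewrite /loewner_le -scalerBl; apply: psdmxZ; last exact/psdmx_exp/kato_psd.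
rewrite subr_ge0.
have bern m (x : C) : 0 <= x -> 1 + m%:R * x <= (1 + x) ^+ m.
  move=> x0; elim: m => [|m IHm]; first by rewrite mul0r addr0 expr0.
  rewrite exprS (@le_trans _ _ ((1 + x) * (1 + m%:R * x)))//.
    rewrite -subr_ge0 (_ : _ - _ = m%:R * x ^+ 2) ?mulr_ge0 ?exprn_ge0//.
    by rewrite -natr1; ring.
  by rewrite ler_wpM2l// addr_ge0.
have := bern k k%:R^-1; rewrite invr_ge0 ler0n => /(_ isT).
by rewrite mulfV// pnatr_eq0 -lt0n.
Qed.

(** If P <= a and Q <= b, then P^n + Q^n <= a^n + b^n <= (a + b)^n for n > 0. *)
Lemma kato_bounded : exists c, forall n, (0 < n)%N -> loewner_le (kato n) c%:M.
Proof.
have [a [a1 Pa _]] := loewner_scalar_min P0.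
have [b [b1 Qb _]] := loewner_scalar_min Q0.
have a0 : 0 <= a by exact: le_trans a1.
have b0 : 0 <= b by exact: le_trans b1.
exists (a + b) => n n0; rewrite -[kato n]expr1 -[_%:M]expr1.
apply: (loewner_heinz (psdmx_scalar d (addr_ge0 a0 b0)) (kato_psd n0) n0).
rewrite kato_exp// scalar_mx_exp.
apply: (@loewner_le_trans _ _ ((a ^+ n)%:M + (b ^+ n)%:M)).
  by rewrite /loewner_le opprD addrACA; apply: psdmxD; exact: loewner_le_scalar_exp.
rewrite /loewner_le -raddfD -raddfB/=; apply: psdmx_scalar; rewrite subr_ge0.
case: n n0 => // n _; rewrite [leRHS]exprS mulrDl lerD//.
  by rewrite exprS ler_wpM2l// lerXn2r ?nnegrE ?addr_ge0// lerDl.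
by rewrite exprS ler_wpM2l// lerXn2r ?nnegrE ?addr_ge0// lerDr.
Qed.
End Kato.

(** * Polar decomposition *)

(** Gram-Schmidt is applied to a row basis of the orthogonal complement of the row space of A. *)
Lemma orthonormal_complement m n (A : 'M[C]_(m, n)) :
  exists K : 'M[C]_(n - \rank A, n),
    [/\ K \is unitarymx, A *m K^t* = 0 & row_full (col_mx A K)].
Proof.
rewrite -rank_ortho.
set B := orthomx _ _ A; exists (schmidt (row_base B)).
have KE : (schmidt (row_base B) :=: B)%MS.
  by apply: eqmx_trans (eqmx_schmidt_free (row_base_free _)) (eq_row_base _).
split; first by rewrite schmidt_unitarymx ?rank_leq_col.
  by apply/orthomx1P; rewrite orthomx_sym KE.
rewrite -sub1mx -addsmxE (adds_eqmx (eqmx_refl A) KE).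
by rewrite addsmx_ortho.
Qed.

(** If u A^* A = 0 then A u^* has norm 0, so the left kernel of A^* A lies in that of A^*. *)
Lemma mxrank_gram m n (A : 'M[C]_(m, n)) : \rank (A^t* *m A) = \rank A.
Proof.
apply/eqP; rewrite eqn_leq mxrankM_maxr/=.
have : (kermx (A^t* *m A) <= kermx (A^t*))%MS.
  apply/row_subP => i; set u := row i _; apply/sub_kermxP.
  have /sub_kermxP uA : (u <= kermx (A^t* *m A))%MS by exact: row_sub.
  have : (A *m u^t*)^t* *m (A *m u^t*) = 0.
    by rewrite adjmxM trmxCK mulmxA -(mulmxA u) uA mul0mx.
  move=> /gram_mx_eq0 /(congr1 (fun X => X^t*)).
  by rewrite adjmxM trmxCK trmx0 map_mx0.
move=> /mxrankS; rewrite !mxrank_ker mxrank_map mxrank_tr.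
have := rank_leq_col A; lia.
Qed.

Lemma psdmx_pinv d (S : 'M[C]_d) : psdmx S ->
  exists J, [/\ J^t* = J, J *m S = S *m J & S *m J *m S = S].
Proof.
move=> S0; have SE := spectral_eq (psdmx_adj S0).
have /unitarymxP PE := spectral_unitarymx S.
set P := spectralmx S in SE PE; set D := spectral_diag S in SE.
(* Since 0^-1 = 0 here, nonzero eigenvalues are inverted and zero ones are kept. *)
exists (P^t* *m diag_mx (map_mx GRing.inv D) *m P).
have mulE (E F : 'rV_d) : P^t* *m diag_mx E *m P *m (P^t* *m diag_mx F *m P) =
    P^t* *m diag_mx (\row_i (E 0 i * F 0 i)) *m P.
  by rewrite !mulmxA -(mulmxA _ P) PE mulmx1 -(mulmxA (P^t*)) mulmx_diag.
split.
- rewrite !adjmxM trmxCK tr_diag_mx map_diag_mx mulmxA; congr (_ *m diag_mx _ *m _).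
  apply/rowP => i; rewrite !mxE; apply: geC0_conj.
  by rewrite invr_ge0 spectral_diag_ge0.
- rewrite SE !mulE; congr (_ *m diag_mx _ *m _); apply/rowP => i.
  by rewrite !mxE mulrC.
- rewrite SE !mulE; congr (_ *m diag_mx _ *m _); apply/rowP => i; rewrite !mxE.
  by have [->|D0] := eqVneq (D 0 i) 0; rewrite ?mulr0// mulfV// mul1r.
Qed.

(* With J the pseudo-inverse of S = |A|, the partial isometry A J is completed
   by an isometry L^* K from ker S onto ker A^*. *)
Lemma polar_decomposition d (A : 'M[C]_d) :
  exists2 U : 'M[C]_d, U \is unitarymx & A = U *m absmx A.
Proof.
have S0 := absmx_psd A; have SS := absmx_sqr A; move: (absmx A) S0 SS => S S0 SS.
have SE := psdmx_adj S0.
have rkS : \rank S = \rank A by rewrite -mxrank_gram SE SS mxrank_gram.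
have [J [JE JS SJS]] := psdmx_pinv S0.
have [K [/unitarymxP KK SK Kfull]] := orthonormal_complement S.
have [L [/unitarymxP LL AL _]] := orthonormal_complement (A^t*).
(* The equality of ranks gives K and L the same number of rows, so that L^* K can be formed. *)
move: L LL AL; rewrite mxrank_map mxrank_tr -rkS => L LL AL.
have LA : L *m A = 0.
  by rewrite -[A]trmxCK -[L]trmxCK -adjmxM AL trmx0 map_mx0.
have KS : K *m S = 0.
  have := congr1 (fun X => X^t*) SK.
  by rewrite adjmxM trmxCK SE trmx0 map_mx0.
(* The Gram matrix of A - A J S vanishes, by A^* A = S S and S J S = S. *)
have AJS : A *m J *m S = A.
  apply/eqP; rewrite eq_sym -subr_eq0; apply/eqP/gram_mx_eq0.
  rewrite adjmxD adjmxN !adjmxM JE SE mulmxBl !mulmxBr !mulmxA -SS.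
  rewrite -(mulmxA _ (A^t*)) -SS !mulmxA.
  rewrite -(mulmxA S S J) -JS !mulmxA SJS subrr sub0r.
  by rewrite -(mulmxA (J *m S *m S) S J) -(mulmxA (J *m S *m S)) SJS subrr oppr0.
have SSJ : S *m S *m J = S by rewrite -mulmxA -JS mulmxA.
pose U := A *m J + L^t* *m K.
have US : U *m S = A by rewrite /U mulmxDl AJS -mulmxA KS mulmx0 addr0.
exists U; last by rewrite US.
have UE : U^t* *m U = S *m J + K^t* *m K.
  rewrite /U adjmxD !adjmxM trmxCK JE mulmxDl !mulmxDr !mulmxA.
  rewrite -(mulmxA J) -SS -(mulmxA J (A^t*)) AL -(mulmxA _ L A) LA.
  rewrite -(mulmxA _ L (L^t*)) LL.
  rewrite !(mulmx0, mul0mx, mulmx1, addr0, add0r) !mulmxA.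
  by rewrite -(mulmxA J) -mulmxA SSJ JS.
have U1 : U^t* *m U = 1%:M.
  (* The rows of S and K together span the space, and right multiplication by U^* U fixes both S and
     K. *)
  apply: (row_full_inj Kfull); rewrite mulmx1 UE mul_col_mx !mulmxDr !mulmxA.
  by rewrite SSJ SK KS KK !(mul0mx, addr0, add0r) mul1mx.
by apply/unitarymxP; rewrite (mulmx1C U1).
Qed.

(** * The block matrix of a modulus, and operations on block matrices *)

Lemma absmx_adj_polar d (A U : 'M[C]_d) : U \is unitarymx ->
  A = U *m absmx A -> absmx (A^t*) = U *m absmx A *m U^t*.
Proof.
move=> U1 AU; have := absmx_sqr (A^t*); have := absmx_psd (A^t*).
move: (absmx _) => T T0; rewrite trmxCK; move: (absmx A) (absmx_psd A) AU.
(* Both sides are positive semidefinite square roots of A A^*. *)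
move=> S S0 -> TT; apply: (sqrmx_inj T0).
  by have := psdmx_congr (U^t*) S0; rewrite trmxCK.
rewrite TT adjmxM (psdmx_adj S0) !mulmxA.
by rewrite -(mulmxA _ (U^t*) U) unitarymxVt// mulmx1.
Qed.

(** With A = U S and |A^*| = U S U^*, the form is that of S at U^* x + y. *)
Lemma block_psd_abs d (A : 'M[C]_d) : block_psd (absmx (A^t*)) A (absmx A).
Proof.
have [U U1 AU] := polar_decomposition A; rewrite (absmx_adj_polar U1 AU).
have S0 := absmx_psd A; move: (absmx A) S0 AU => S S0 -> x y.
rewrite (_ : _ + _ = (U^t* *m x + y)^t* *m S *m (U^t* *m x + y)) ?psdmx_ge0//.
rewrite adjmxD !adjmxM trmxCK (psdmx_adj S0) !mulmxDl !mulmxDr !mulmxA.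
by rewrite addrAC !addrA.
Qed.

Lemma block_psd_sum d (I : Type) (r : seq I) (P H Q : I -> 'M[C]_d) :
  (forall i, block_psd (P i) (H i) (Q i)) ->
  block_psd (\sum_(i <- r) P i) (\sum_(i <- r) H i) (\sum_(i <- r) Q i).
Proof.
move=> PHQ x y; elim: r => [|i r IHr].
  by rewrite !big_nil trmx0 map_mx0 !mulmx0 !mul0mx !addr0 mxE.
have := addr_ge0 (PHQ i x y) IHr.
have mxD (M N : 'M[C]_1) : M 0 0 + N 0 0 = (M + N) 0 0 by rewrite mxE.
rewrite mxD; congr (0 <= fun_of_matrix _ 0 0).
rewrite !big_cons adjmxD !mulmxDr !mulmxDl.
by rewrite addrACA; congr (_ + _); rewrite addrACA.
Qed.

Lemma block_psd_congrl d (P H Q U : 'M[C]_d) :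
  block_psd P H Q -> block_psd (U^t* *m P *m U) (U^t* *m H) Q.
Proof.
by move=> PHQ x y; have := PHQ (U *m x) y; rewrite !adjmxM trmxCK !mulmxA.
Qed.

Lemma block_psd_sym d (P H Q : 'M[C]_d) : H^t* = H ->
  block_psd P H Q -> block_psd Q H P.
Proof.
move=> HE PHQ x y; have := PHQ y x; rewrite HE; congr (0 <= fun_of_matrix _ 0 0).
by rewrite addrC; congr (_ + _); rewrite addrC.
Qed.

Lemma loewner_le_sesq d (X Y : 'M[C]_d) (u : 'cV_d) :
  loewner_le X Y -> (u^t* *m X *m u) 0 0 <= (u^t* *m Y *m u) 0 0.
Proof.
move=> /(psdmx_ge0 u).
by rewrite mulmxBr mulmxBl mxE [X in _ + X]mxE subr_ge0.
Qed.

Lemma loewner_le_sesqZ d (X Y : 'M[C]_d) a (u : 'cV_d) :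
  loewner_le X (a *: Y) -> (u^t* *m X *m u) 0 0 <= a * (u^t* *m Y *m u) 0 0.
Proof.
move=> /(loewner_le_sesq u).
by rewrite -scalemxAr -scalemxAl [leRHS]mxE.
Qed.

End Psd.

(** * Limits *)

Section Limits.
Local Open Scope classical_set_scope.
Variable C : numClosedFieldType.

Lemma cvg_finsum (I T : Type) (F : set_system T) (r : seq I)
    (f : I -> T -> C) (l : I -> C) : Filter F ->
  (forall i, f i t @[t --> F] --> l i) ->
  \sum_(i <- r) f i t @[t --> F] --> \sum_(i <- r) l i.
Proof.
move=> FF fl; elim: r => [|i r IHr].
  by under eq_fun do rewrite big_nil; rewrite big_nil; exact: cvg_cst.
by under eq_fun do rewrite big_cons; rewrite big_cons; exact: cvgD.
Qed.

Lemma cvg_conjC (T : Type) (F : set_system T) (f : T -> C) (l : C) :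
  Filter F -> f t @[t --> F] --> l -> (f t)^* @[t --> F] --> l^*.
Proof.
move=> FF /cvgrPdist_lt fl; apply/cvgrPdist_lt => e /fl; apply: filterS => t.
by rewrite -rmorphB norm_conjC.
Qed.

(** The values agree with their norms near F, so l = |l| by uniqueness of limits. *)
Lemma lim_ge0 (T : Type) (F : set_system T) (f : T -> C) (l : C) :
  ProperFilter F -> (\forall t \near F, 0 <= f t) -> f t @[t --> F] --> l ->
  0 <= l.
Proof.
move=> FF f0 fl; have fl' : `|f t| @[t --> F] --> l.
  apply: cvg_trans fl; apply: near_eq_cvg; apply: filterS f0 => t f0.
  by rewrite ger0_norm.
by rewrite (cvg_unique (@norm_hausdorff _ _) fl' (cvg_norm fl)).
Qed.

Lemma cvg_mxP (T : Type) (F : set_system T) m n (G : T -> 'M[C]_(m, n))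
    (L : 'M[C]_(m, n)) :
  Filter F -> G t @[t --> F] --> L <->
  forall i j, G t i j @[t --> F] --> L i j.
Proof.
move=> FF; split=> [GL i j|GL].
  by apply: (cvg_comp G (fun M => M i j)); [exact: GL|exact: coord_continuous].
move=> A [P LP PA]; apply: (@filterS _ F _ _ _ (fun t h => PA (G t) h)).
by apply: filter_forall => i; apply: filter_forall => j; exact: GL (LP i j).
Qed.

Lemma psdmx_lim (T : Type) (F : set_system T) d (G : T -> 'M[C]_d)
    (L : 'M[C]_d) :
  ProperFilter F -> (\forall t \near F, psdmx (G t)) -> G t @[t --> F] --> L ->
  psdmx L.
Proof.
move=> FF G0 /cvg_mxP GL; apply: psdmxI => [|u].
  apply/matrixP => i j; rewrite !mxE.
  have GLc : G t i j @[t --> F] --> (L j i)^*.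
    have GLc : (G t j i)^* @[t --> F] --> (L j i)^* by exact: cvg_conjC.
    apply: cvg_trans GLc; apply: near_eq_cvg.
    apply: filterS G0 => t /psdmx_adj /matrixP/(_ i j) <-.
    by rewrite !mxE.
  exact: (cvg_unique (@norm_hausdorff _ _) GLc (GL i j)).
apply: (@lim_ge0 _ F (fun t => (u^t* *m G t *m u) 0 0)).
  by apply: filterS G0 => t /psdmx_ge0.
under eq_fun do rewrite mxE; rewrite mxE.
apply: cvg_finsum => j; apply: cvgM; last exact: cvg_cst.
under eq_fun do rewrite mxE; rewrite mxE.
by apply: cvg_finsum => i; apply: cvgM; [exact: cvg_cst|exact: GL].
Qed.

Lemma loewner_le_lim (T : Type) (F : set_system T) d (G : T -> 'M[C]_d)
    (L B : 'M[C]_d) :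
  ProperFilter F -> (\forall t \near F, loewner_le B (G t)) ->
  G t @[t --> F] --> L -> loewner_le B L.
Proof.
move=> FF BG /cvg_mxP GL; apply: (@psdmx_lim T F d (fun t => G t - B) _ FF BG).
apply/cvg_mxP => i j.
under eq_fun do rewrite mxE; rewrite mxE.
by apply: cvgD; [exact: GL|exact: cvg_cst].
Qed.

Lemma sesq_polarization d (M : 'M[C]_d) (u v : 'cV[C]_d) :
  let q (w : 'cV[C]_d) : C := (w^t* *m M *m w) 0 0 in
  (u^t* *m M *m v) 0 0 =
    2^-1 * (q (u + v) - q u - q v - 'i * (q (u + 'i *: v) - q u - q v)).
Proof.
move=> q; pose B (w z : 'cV[C]_d) : C := (w^t* *m M *m z) 0 0.
rewrite -[LHS]/(B u v).
have eD (X Y : 'M[C]_1) : (X + Y) 0 0 = X 0 0 + Y 0 0 by rewrite mxE.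
have eZ a (X : 'M[C]_1) : (a *: X) 0 0 = a * X 0 0 by rewrite mxE.
have qD : q (u + v) = q u + q v + B u v + B v u.
  rewrite /q /B adjmxD !mulmxDl !mulmxDr !eD; ring.
have qDi : q (u + 'i *: v) = q u + q v + 'i * B u v - 'i * B v u.
  rewrite /q /B adjmxD adjmxZ conjCi !mulmxDl !mulmxDr.
  rewrite -!scalemxAr -!scalemxAl !(eD, eZ).
  have := sqrCi C; set i := 'i => i2; ring: i2.
rewrite qD qDi; have := sqrCi C.
by set i := 'i => i2; field: i2.
Qed.

(** By polarization each entry is a fixed combination of four values of the quadratic form; matrix
    limits thus reduce to scalar ones. *)
Lemma cvg_mx_sesq (T : Type) (F : set_system T) d (G : T -> 'M[C]_d) :
  Filter F -> (forall u : 'cV[C]_d, cvg ((u^t* *m G t *m u) 0 0 @[t --> F])) ->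
  cvg (G t @[t --> F]).
Proof.
move=> FF qcv; suff ecv i j : cvg (G t i j @[t --> F]).
  apply/cvg_ex; exists (\matrix_(i, j) lim (G t i j @[t --> F])).
  by apply/cvg_mxP => i j; rewrite mxE; exact: ecv.
pose u : 'cV[C]_d := delta_mx i 0; pose v : 'cV[C]_d := delta_mx j 0.
have GE t : G t i j = (u^t* *m G t *m v) 0 0.
  rewrite /u /v -mulmxA -colE mxE (bigD1 i)//= !mxE !eqxx conjC1 mul1r.
  by rewrite big1 ?addr0// => k /negPf ki; rewrite !mxE ki conjC0 mul0r.
under eq_fun do rewrite GE sesq_polarization.
pose q w t := (w^t* *m G t *m w) 0 0.
have /cvg_ex[l1 cu] := qcv u; have /cvg_ex[l2 cv] := qcv v.
have /cvg_ex[l3 cuv] := qcv (u + v); have /cvg_ex[l4 cuiv] := qcv (u + 'i *: v).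
apply/cvg_ex; exists (2^-1 * (l3 - l1 - l2 - 'i * (l4 - l1 - l2))).
apply: cvgMl_tmp; apply: cvgB; first by apply: cvgB cv; exact: cvgB.
by apply: cvgMl_tmp; apply: cvgB cv; exact: cvgB.
Qed.

Lemma lim_kato_ge d (P Q : 'M[C]_d) : psdmx P -> psdmx Q ->
  cvg (kato P Q n @[n --> \oo]) ->
  loewner_le P (lim (kato P Q n @[n --> \oo])) /\
  loewner_le Q (lim (kato P Q n @[n --> \oo])).
Proof.
move=> P0 Q0; move: (lim _) => L PQ; split; apply: loewner_le_lim PQ.
  by exists 1%N => // n n0; have [] := kato_ge P0 Q0 n0.
by exists 1%N => // n n0; have [] := kato_ge P0 Q0 n0.
Qed.

Lemma near_at_right (P : C -> Prop) (a : C) : 0 < a ->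
  (forall e, 0 < e -> e < a -> P e) -> \forall e \near (0 : C)^'+, P e.
Proof.
move=> a0 aP; exists a => //= e; rewrite /= sub0r normrN => ea e0.
by apply: aP => //; rewrite gtr0_norm in ea.
Qed.

(** Adding e to the diagonal blocks keeps H admissible, so H lies below every term of the limit. *)
Lemma lim_geomean_pd_max d (X Y H : 'M[C]_d) :
  cvg (geomean_pd (X + e%:M) (Y + e%:M) @[e --> (0 : C)^'+]) ->
  psdmx X -> psdmx Y -> H^t* = H -> block_psd X H Y ->
  loewner_le H (lim (geomean_pd (X + e%:M) (Y + e%:M) @[e --> (0 : C)^'+])).
Proof.
move: (lim _) => L XY X0 Y0 HE XHY; apply: loewner_le_lim XY.
apply: (@near_at_right _ 1) => // e e0 _.
have addE (Z : 'M[C]_d) : loewner_le Z (Z + e%:M).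
  by rewrite /loewner_le addrAC subrr add0r; exact: psdmx_scalar (ltW e0).
apply: geomean_pd_max HE _.
- exact: psdmx_add_scalar (ltW e0).
- exact: unitmx_add_scalar.
- exact: psdmx_add_scalar (ltW e0).
- exact: block_psd_le (addE X) (addE Y) XHY.
Qed.

End Limits.

(** * Convergence of Kato's sequence and of the regularized geometric mean *)

Section ComplexLimits.
Local Open Scope classical_set_scope.
Local Open Scope complex_scope.
Variable R : realType.

Lemma ge0_complexE (x : R[i]) : 0 <= x -> x = (complex.Re x)%:C.
Proof. by move=> x0; rewrite RRe_real// ger0_real. Qed.

(** Nonnegative values equal their real parts; this transfers suprema and infima taken in [R] to
    limits in [R[i]]. *)
Lemma cvg_ge0_complex (T : Type) (F : set_system T) 
    (f : T -> (R[i] : numClosedFieldType)) (l : R) :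
  Filter F -> (\forall t \near F, 0 <= f t) ->
  (forall e, 0 < e -> \forall t \near F, l - e < complex.Re (f t) < l + e) ->
  f t @[t --> F] --> (l%:C : (R[i] : numClosedFieldType)).
Proof.
move=> FF f0 fl; apply/cvgrPdist_lt => e e0.
have eE := ge0_complexE (ltW e0).
have /fl : 0 < complex.Re e by rewrite -ltcR -eE.
apply: filterS2 f0 => t /ge0_complexE ftE lf; rewrite ftE -rmorphB.
by rewrite normc_def/= expr0n addr0 sqrtr_sqr eE ltcR ltr_distlC.
Qed.

(** The values r_n of the form tend to s, the supremum of all r_k / (1 + 1/k): r_n <= (1 + 1/n) s
    always, and r_n >= r_k / (1 + 1/k) once n >= k. *)
Lemma cvg_kato d (P Q : 'M[R[i]]_d) : psdmx P -> psdmx Q ->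
  cvg (kato P Q n @[n --> \oo]).
Proof.
move=> P0 Q0; apply: cvg_mx_sesq => u.
set f := fun n => (u^t* *m kato P Q n *m u) 0 0.
pose r n := complex.Re (f n).
have f0 n : (0 < n)%N -> 0 <= f n by move=> n0; apply/psdmx_ge0/kato_psd.
have fE n : (0 < n)%N -> f n = (r n)%:C by move=> n0; apply/ge0_complexE/f0.
have r0 n : (0 < n)%N -> 0 <= r n by move=> n0; rewrite -lecR -fE// f0.
have rle k n : (0 < k)%N -> (k <= n)%N -> r k <= (1 + k%:R^-1) * r n.
  move=> k0 kn; have n0 : (0 < n)%N := leq_trans k0 kn.
  have : f k <= (1 + k%:R^-1) * f n.
    exact: loewner_le_sesqZ (kato_almost_incr P0 Q0 k0 kn).
  rewrite !fE// -(rmorph_nat (real_complex R)) -fmorphV.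
  by rewrite -(rmorph1 (real_complex R)) -rmorphD -rmorphM lecR.
have [b rb] : exists b, forall n, (0 < n)%N -> r n <= b.
  have [c cP] := kato_bounded P0 Q0; pose q := c * (u^t* *m u) 0 0.
  exists (complex.Re q) => n n0; have fq : f n <= q.
    have := loewner_le_sesqZ u (a := c) (Y := 1%:M).
    by rewrite scalemx1 mulmx1; apply; exact: cP.
  by rewrite -lecR -fE// -ge0_complexE// (le_trans (f0 n n0)).
pose E := [set x | exists2 k, (0 < k)%N & x = r k / (1 + k%:R^-1)].
have k1 k : 0 < 1 + k%:R^-1 :> R by rewrite ltr_wpDr ?invr_ge0.
have rE k : (0 < k)%N -> r k / (1 + k%:R^-1) <= r k.
  by move=> k0; rewrite ler_pdivrMr// ler_peMr ?r0// lerDl invr_ge0.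
have supE : has_sup E.
  split; first by exists (r 1%N / (1 + 1%:R^-1)), 1%N.
  by exists b => _ [k k0 ->]; apply: le_trans (rE k k0) (rb k k0).
have r_sup n : (0 < n)%N -> r n <= (1 + n%:R^-1) * sup E.
  move=> n0; rewrite -ler_pdivrMl// mulrC; apply: ub_le_sup; first by case: supE.
  by exists n.
have sup0 : 0 <= sup E.
  have := r_sup 1%N isT; have := r0 1%N isT => h1 /(le_trans h1).
  by rewrite pmulr_rge0.
apply/cvg_ex; exists (sup E)%:C; apply: cvg_ge0_complex => [|e e0].
  by near=> n; apply: f0; near: n; exists 1%N.
have [_ [k k0 ->] ke] := sup_adherent e0 supE.
near=> n.
have n0 : (0 < n)%N by near: n; exists 1%N.
have kn : (k <= n)%N by near: n; exists k.
apply/andP; split.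
  by apply: lt_le_trans ke _; rewrite ler_pdivrMr// mulrC rle.
apply: le_lt_trans (r_sup n n0) _; rewrite mulrDl mul1r ltrD2l.
rewrite mulrC ltr_pdivrMr ?ltr0n//.
(* Beyond this N the excess [sup E] / n is below e. *)
near: n; have [N NP] : exists N : nat, sup E / e < N%:R.
  exists (Num.truncn (sup E / e)).+1; exact: truncnS_gt.
exists N => // n /= Nn; rewrite mulrC -ltr_pdivrMr//.
by apply: lt_le_trans NP _; rewrite ler_nat.
Unshelve. all: by end_near. Qed.

(** The mean at e stays admissible when the diagonal blocks grow to those at e', so maximality at e'
    applies. *)
Lemma geomean_pd_mono d (X Y : 'M[R[i]]_d) e e' : psdmx X -> psdmx Y ->
  0 < e -> e <= e' ->
  loewner_le (geomean_pd (X + e%:M) (Y + e%:M)) (geomean_pd (X + e'%:M) (Y + e'%:M)).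
Proof.
move=> X0 Y0 e0 ee; have e'0 : 0 < e' := lt_le_trans e0 ee.
have XeP := psdmx_add_scalar X0 (ltW e0); have XeU := unitmx_add_scalar X0 e0.
have YeP := psdmx_add_scalar Y0 (ltW e0).
have sE (Z : 'M[R[i]]_d) : loewner_le (Z + e%:M) (Z + e'%:M).
  rewrite /loewner_le opprD addrACA subrr add0r -raddfB/=.
  by apply: psdmx_scalar; rewrite subr_ge0.
apply: geomean_pd_max (psdmx_adj (geomean_pd_psd XeP YeP)) _.
- exact: psdmx_add_scalar (ltW e'0).
- exact: unitmx_add_scalar.
- exact: psdmx_add_scalar (ltW e'0).
- exact: block_psd_le (sE X) (sE Y) (geomean_pd_block XeP XeU YeP).
Qed.

(** The form is nonnegative and nondecreasing in e, so it tends to its infimum as e decreases to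
    0. *)
Lemma cvg_geomean d (X Y : 'M[R[i]]_d) : psdmx X -> psdmx Y ->
  cvg (geomean_pd (X + e%:M) (Y + e%:M) @[e --> (0 : R[i])^'+]).
Proof.
move=> X0 Y0; apply: cvg_mx_sesq => u.
set f := fun e => (u^t* *m geomean_pd (X + e%:M) (Y + e%:M) *m u) 0 0.
have f0 e : 0 < e -> 0 <= f e.
  by move=> e0; apply/psdmx_ge0/geomean_pd_psd; apply: psdmx_add_scalar => //; exact: ltW.
have fle e e' : 0 < e -> e <= e' -> f e <= f e'.
  by move=> e0 ee; exact: loewner_le_sesq (geomean_pd_mono X0 Y0 e0 ee).
clearbody f.
pose E := [set x | exists2 e, 0 < e & x = complex.Re (f e)].
have infE : has_inf E.
  split; first by exists (complex.Re (f 1)), 1.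
  by exists 0 => _ [e e0 ->]; rewrite -lecR -ge0_complexE f0.
apply/cvg_ex; exists (inf E)%:C; apply: cvg_ge0_complex => [|e e0].
  by apply: (@near_at_right _ _ 1) => // e e0 _; exact: f0.
have [_ [a a0 ->] ae] := inf_adherent e0 infE.
apply: (near_at_right a0) => t t0 /ltW ta; apply/andP; split.
  rewrite ltrBlDr (@le_lt_trans _ _ (complex.Re (f t)))// ?ltrDl//.
  by apply: ge_inf; [case: infE|exists t].
apply: le_lt_trans ae; rewrite -lecR.
by rewrite -(ge0_complexE (f0 _ t0)) -(ge0_complexE (f0 _ a0)) fle.
Qed.

End ComplexLimits.

(** * Bounds for the maximal modulus and the final inequality *)

Section MaxModulus.
Local Open Scope classical_set_scope.
Variables (R : realType) (d : nat).

Lemma maxabsmx_ge (A : 'M[R[i]]_d) :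
  loewner_le (absmx A) (maxabsmx A) /\ loewner_le (absmx (A^t*)) (maxabsmx A).
Proof.
have P0 := absmx_psd A; have Q0 := absmx_psd (A^t*).
exact: (lim_kato_ge P0 Q0 (cvg_kato P0 Q0)).
Qed.

Lemma maxabsmx_psd (A : 'M[R[i]]_d) : psdmx (maxabsmx A).
Proof.
have [AA _] := maxabsmx_ge A; have := psdmxD AA (absmx_psd A).
by rewrite subrK.
Qed.

Lemma geomean_max (X Y H : 'M[R[i]]_d) : psdmx X -> psdmx Y -> H^t* = H ->
  block_psd X H Y -> loewner_le H (geomean X Y).
Proof.
by move=> X0 Y0; exact: (lim_geomean_pd_max (cvg_geomean X0 Y0) X0 Y0).
Qed.

Lemma absmx_le_geomean (B S : 'M[R[i]]_d) : psdmx S -> block_psd S B S ->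
  exists2 V : 'M[R[i]]_d, V \is unitarymx &
    loewner_le (absmx B) (geomean S (V *m S *m V^t*)).
Proof.
move=> S0 SBS; have [U U1 BU] := polar_decomposition B.
have := psdmx_adj (absmx_psd B); move: (absmx B) BU => T BU TE.
exists (U^t*); first by rewrite trmxC_unitary.
rewrite trmxCK; apply: (geomean_max S0 (psdmx_congr U S0) TE).
(* The congruence puts U^* S U in the upper left corner; as |B| is Hermitian, the two diagonal
   blocks may be exchanged. *)
apply: (block_psd_sym TE); have := block_psd_congrl U SBS.
suff -> : U^t* *m B = T by [].
by rewrite BU mulmxA (unitarymxVt U1) mul1mx.
Qed.

End MaxModulus.

Theorem theorem3p4 (R : realType) (d m : nat) (hd : (0 < d)%N) (hm : (0 < m)%N)
    (A : 'I_m -> 'M[R[i]]_d) :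
  exists2 V : 'M[R[i]]_d, V \is unitarymx &
    loewner_le (absmx (\sum_(k < m) A k))
      (geomean (\sum_(k < m) maxabsmx (A k))
               (V *m (\sum_(k < m) maxabsmx (A k)) *m V^t*)).
Proof.
apply: absmx_le_geomean; first by apply: psdmx_sum => k _; exact: maxabsmx_psd.
apply: block_psd_sum => k; have [Ak Aka] := maxabsmx_ge (A k).
exact: block_psd_le Aka Ak (block_psd_abs (A k)).
Qed.
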